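(* Let $k\in\mathbb{N}$ and $r\in\{0,1,\dots,k\}$. For every nonzero $f\in W_{kr}$ there exists a constant $C_{f,\mathbf{p}}>0$ such that $$ n^r\,\mathbb{E}_{w\sim\mathcal{W}(n,\mathbf{p})}\left[\left(\bar\# f(w)\right)^2\right]\;\xrightarrow[n\to\infty]{}\;C_{f,\mathbf{p}} . $$ Moreover, for every $r'\in\{0,\dots,k\}$ with $r'\neq r$ and every $f'\in W_{kr'}$, $$\mathbb{E}_{w\sim\mathcal{W}(n,\mathbf{p})}\left[\bar\# f(w)\;\bar\# f'(w)\right]=0 .$$
   Context: $\Sigma$ is a finite alphabet with $d=|\Sigma|\ge 2$, and $\mathbf{p}=(p_x)_{x\in\Sigma}$ with $p_x\in(0,1)$, $\sum_x p_x=1$. $\mathcal{W}(n,\mathbf{p})$ is the distribution of a random word $w\in\Sigma^n$ with independent letters, each equal to $x$ with probability $p_x$. For $u\in\Sigma^k$, $w\in\Sigma^n$ ($n\ge k$), $\#u(w)$ is the number of tuples $1\le t_1<\dots<t_k\le n$ with $w_{t_1}\cdots w_{t_k}=u$, and $\bar\#u(w)=\#u(w)/\binom nk$. Let $W_k=\mathbb{R}\Sigma^k$ be the space of formal real combinations $f=\sum_{u\in\Sigma^k}f_u u$; extend $\#$ and $\bar\#$ linearly: $\bar\#f=\sum_u f_u\bar\#u$. Inner product on $W_k$: $\langle f,f'\rangle_{\mathbf p}=\sum_{u\in\Sigma^k}p_uf_uf'_u$, where $p_u=p_{u_1}\cdots p_{u_k}$. In $\mathbb{R}\Sigma=W_1$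 let $\mathbf{1}:=\sum_{x\in\Sigma}x$ and complete it to an orthonormal basis $D=\{\mathbf 1,\mathbf 2,\dots,\mathbf d\}$ of $W_1$ with respect to $\langle\cdot,\cdot\rangle_{\mathbf p}$. Using bilinear concatenation, every word $e=e_1\cdots e_k\in D^k$ is an element of $W_k$, and $D^k$ is an orthonormal basis of $W_k$. Define $W_{kr}=\mathrm{span}\{e\in D^k: \text{exactly } k-r \text{ letters of } e \text{ equal } \mathbf 1\}$ (this does not depend on the choice of $\mathbf 2,\dots,\mathbf d$). *)

(* Defs.v *)
From mathcomp Require Import all_boot all_order all_algebra.
From mathcomp Require Import all_classical all_reals all_analysis.

Set Implicit Arguments.
Unset Strict Implicit.
Unset Printing Implicit Defensive.

Import Order.TTheory GRing.Theory Num.Theory.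
Import numFieldNormedType.Exports.

Local Open Scope ring_scope.

(* [R^o] rather than [R] is what gives this type its vector space structure. *)
Definition W (R : realType) (Sigma : finType) (k : nat) : vectType R :=
  {ffun k.-tuple Sigma -> R^o}.

Definition coef (R : realType) (Sigma : finType) (k : nat)
  (f : W R Sigma k) (u : k.-tuple Sigma) : R :=
  (f : {ffun k.-tuple Sigma -> R^o}) u.

Definition word (R : realType) (Sigma : finType) (k : nat)
  (u : k.-tuple Sigma) : W R Sigma k := [ffun v => (v == u)%:R : R^o].

Definition is_letter_distr (R : realType) (Sigma : finType)
  (p : Sigma -> R) : Prop :=
  (forall x, 0 < p x < 1) /\ \sum_(x : Sigma) p x = 1.

Definition word_prob (R : realType) (Sigma : finType) (p : Sigma -> R)
  (n : nat) (w : n.-tuple Sigma) : R := \prod_(i < n) p (tnth w i).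

Definition expect (R : realType) (Sigma : finType) (p : Sigma -> R)
  (n : nat) (X : n.-tuple Sigma -> R) : R :=
  \sum_(w : n.-tuple Sigma) word_prob p w * X w.

Definition occ (Sigma : finType) (k n : nat)
  (u : k.-tuple Sigma) (w : n.-tuple Sigma) : nat :=
  #|[set t : k.-tuple 'I_n |
      [forall i : 'I_k, forall j : 'I_k, (i < j)%N ==> (tnth t i < tnth t j)%N]
      && [forall i : 'I_k, tnth w (tnth t i) == tnth u i]]|.

(* Meaningful for [k <= n]; the binomial coefficient vanishes otherwise. *)
Definition occ_density (R : realType) (Sigma : finType) (k n : nat)
  (u : k.-tuple Sigma) (w : n.-tuple Sigma) : R :=
  (occ u w)%:R / 'C(n, k)%:R.

Definition density (R : realType) (Sigma : finType) (k n : nat)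
  (f : W R Sigma k) (w : n.-tuple Sigma) : R :=
  \sum_(u : k.-tuple Sigma) coef f u * occ_density R u w.

Definition inner (R : realType) (Sigma : finType) (p : Sigma -> R)
  (k : nat) (f g : W R Sigma k) : R :=
  \sum_(u : k.-tuple Sigma) word_prob p u * coef f u * coef g u.

Definition one_letter (R : realType) (Sigma : finType) : W R Sigma 1 :=
  \sum_(x : Sigma) word R [tuple x].

Definition is_orthonormal_basis_with_one (R : realType) (Sigma : finType)
  (p : Sigma -> R) (D : #|Sigma|.-tuple (W R Sigma 1)) : Prop :=
  [/\ one_letter R Sigma \in D,
      forall i j, inner p (tnth D i) (tnth D j) = (i == j)%:R
    & basis_of fullv D].

(* Multilinear extension of the concatenation of [k] one-letter words. *)
Definition concat (R : realType) (Sigma : finType) (k : nat)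
  (v : 'I_k -> W R Sigma 1) : W R Sigma k :=
  \sum_(u : k.-tuple Sigma)
    (\prod_(i < k) coef (v i) [tuple tnth u i]) *: word R u.

(* A word over [D] is given by the positions of its letters in [D]. *)
Definition Wkr (R : realType) (Sigma : finType)
  (D : #|Sigma|.-tuple (W R Sigma 1)) (k r : nat) : {vspace W R Sigma k} :=
  <<[seq concat (fun i => tnth D (tnth e i)) |
      e : k.-tuple 'I_#|Sigma| in
      [pred e : k.-tuple 'I_#|Sigma| |
        #|[set i : 'I_k | tnth D (tnth e i) == one_letter R Sigma]|
          == (k - r)%N]]>>%VS.

(* Main.v *)
Require Import Defs.
From mathcomp Require Import all_boot all_order all_algebra.
From mathcomp Require Import all_classical all_reals all_analysis.
From mathcomp Require Import zify ring.

Set Implicit Arguments.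
Unset Strict Implicit.
Unset Printing Implicit Defensive.

Import Order.TTheory GRing.Theory Num.Theory.
Import numFieldNormedType.Exports.

(* Let [#e(w)] denote the sum over positions t_1 < ... < t_k of the products
   e_1(w_(t_1)) ... e_k(w_(t_k)), for a word e over the orthonormal basis D.
   Removing the first letter of w shows that E[#e #e'] satisfies a Pascal-type
   recursion in n, whose solution is \sum_m C(n, m) P_m(e, e') with P_m(e, e') a
   number of overlaps of e and e'.  P_m(e, e') vanishes unless e and e' have the
   same number r of letters different from 1 and m + r <= 2k: this gives the
   orthogonality, and the convergence, the limit being the quadratic form with
   matrix P_(2k-r)(e, e') k!^2 / (2k-r)!.  By Vandermonde's convolution,
   P_(2k-r)(e, e') = \sum_i L(e, i) L(e', i), where L(e, i) is the number of ways
   to obtain i by deleting letters 1 from e; as L(e, i) = [e = i] for words of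
   the same length, the form is positive definite. *)

(** * Combinatorics of overlapping words and of deleting ones *)

Section Overlaps.
Variables (T : finType) (o : T).
Implicit Types (e i : seq T) (v : seq T -> nat).

Definition nonones e : nat := count (predC1 o) e.
Arguments nonones : simpl never.

Lemma nonones_nil : nonones [::] = 0.
Proof. by []. Qed.

Lemma nonones_cons a e : nonones (a :: e) = (a != o) + nonones e.
Proof. by []. Qed.

Lemma nonones_size e : nonones e <= size e.
Proof. exact: count_size. Qed.

(* Number of pairs of increasing maps from the positions of [e] and of [e'] to
   [m] points, jointly onto, such that [e] and [e'] induce the same labelling of
   the points by letters once the missing labels are read as [o]. *)
Fixpoint overlaps m e e' : nat :=
  match m, e, e' with
  | 0, [::], [::] => 1
  | m'.+1, a :: e1, [::] => (a == o) * overlaps m' e1 [::]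
  | m'.+1, [::], b :: e2 => (b == o) * overlaps m' [::] e2
  | m'.+1, a :: e1, b :: e2 =>
      (b == o) * overlaps m' e e2 + (a == o) * overlaps m' e1 e'
      + (a == b) * overlaps m' e1 e2
  | _, _, _ => 0
  end.

(** A point hit by only one of the words must carry [o], so each letter other than [o] is matched
    with an equal letter of the other word. Hence at least [nonones e] points are hit twice, which
    bounds [m]. *)
Lemma overlaps_neq0 m e e' : overlaps m e e' != 0 ->
  nonones e = nonones e' /\ m + nonones e <= size e + size e'.
Proof.
elim: m e e' => [|m IHm] [|a e] [|b e'] //=; rewrite ?nonones_cons.
- by case: (b == o); rewrite ?mul0n ?mul1n // => /IHm/=; lia.
- by case: (a == o); rewrite ?mul0n ?mul1n // => /IHm/=; lia.
rewrite !addn_eq0 !muln_eq0 !negb_and !negb_or -orbA !eqb0 !negbK.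
by case/or3P=> /andP[/eqP-> /IHm]; rewrite ?nonones_cons ?eqxx /=; lia.
Qed.

Lemma overlaps_eq0 m e e' : size e + size e' < m + nonones e ->
  overlaps m e e' = 0.
Proof.
move=> ltm; apply/eqP; apply: contraLR ltm => /overlaps_neq0[_].
by rewrite -leqNgt.
Qed.

(* Number of ways to obtain [i] by deleting letters [o] from [e]. *)
Fixpoint deletions e i : nat :=
  match e, i with
  | [::], [::] => 1
  | [::], _ => 0
  | a :: e1, [::] => (a == o) * deletions e1 i
  | a :: e1, b :: i1 => (b == a) * deletions e1 i1 + (a == o) * deletions e1 i
  end.

Lemma deletions_size e i : size e < size i -> deletions e i = 0.
Proof.
elim: e i => [|a e IHe] [|b i] //= lti.
by rewrite !IHe ?muln0 // ltnW.
Qed.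

Lemma deletions_same_size e i : size e = size i -> deletions e i = (e == i).
Proof.
elim: e i => [|a e IHe] [|b i] //= [eq_sz].
rewrite IHe // deletions_size /= ?eq_sz // muln0 addn0 eqseq_cons eq_sym.
by case: (a == b); case: (e == i).
Qed.

(** A finite index set for the Gram sums: the words of length at most [K]. *)
Fixpoint words K : seq (seq T) :=
  if K is K'.+1 then [::] :: [seq b :: i | b <- enum T, i <- words K']
  else [:: [::]].

Lemma mem_words K i : size i <= K -> i \in words K.
Proof.
elim: K i => [|K IHK] [|b i] //= lei; rewrite in_cons //=.
by apply/allpairsP; exists (b, i); rewrite mem_enum IHK.
Qed.

Lemma big_wordsS K v :
  \sum_(i <- words K.+1) v i
  = v [::] + \sum_(b : T) \sum_(i <- words K) v (b :: i).
Proof. by rewrite big_cons big_allpairs_dep big_enum. Qed.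

Lemma big_words_widen K v : (forall i, K < size i -> v i = 0) ->
  \sum_(i <- words K.+1) v i = \sum_(i <- words K) v i.
Proof.
elim: K v => [|K IHK] v v0; rewrite big_wordsS.
  by rewrite /= big_seq1 big1 ?addn0 // => b _; rewrite big_seq1 v0.
rewrite big_wordsS; congr addn; apply: eq_bigr => b _.
by apply: IHK => i lti; apply: v0.
Qed.

(** Gram matrix of the vectors [deletions e _]. Its value is independent of [K] once [K] bounds the
    length of either word. *)
Definition gram K e e' := \sum_(i <- words K) deletions e i * deletions e' i.

Lemma gram_widen K e e' : size e <= K -> gram K.+1 e e' = gram K e e'.
Proof.
move=> leK; apply: big_words_widen => i lti.
by rewrite deletions_size // (leq_ltn_trans leK).
Qed.

Lemma gramC K e e' : gram K e e' = gram K e' e.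
Proof. by apply: eq_bigr => i _; rewrite mulnC. Qed.

Lemma gram_nil K : gram K [::] [::] = 1.
Proof.
case: K => [|K]; first by rewrite /gram big_seq1.
by rewrite /gram big_wordsS big1 // => b _; rewrite big1.
Qed.

(** Only the empty [i] contributes, and reaching it forces the deletion of the leading [o]. *)
Lemma gram_one_nil K e : size e < K -> gram K (o :: e) [::] = gram K e [::].
Proof.
case: K => // K ltK; rewrite /gram !big_wordsS /= eqxx mul1n.
by congr addn; apply: eq_bigr => b _; apply: eq_bigr => i _; rewrite !muln0.
Qed.

(** Every word reached from [b :: e'] starts with [b], so the leading [o] of the other word has to
    be deleted. *)
Lemma gram_one_neq K b e e' : b != o ->
  gram K.+1 (o :: e) (b :: e') = gram K.+1 e (b :: e').
Proof.
move=> /negPf nbo; rewrite /gram !big_wordsS /= nbo !muln0; congr addn.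
apply: eq_bigr => c _; apply: eq_bigr => i _.
rewrite eqxx mul0n addn0 mul1n mulnDl.
case: (c =P b) => [->|_]; last by rewrite !mul0n !muln0.
by rewrite nbo.
Qed.

(** The leading [a] cannot be deleted, so every contributing [i] starts with it. *)
Lemma gram_neq K a e e' : a != o ->
  gram K.+1 (a :: e) (a :: e') = gram K e e'.
Proof.
move=> /negPf nao; rewrite /gram big_wordsS /= nao !mul0n add0n.
rewrite (bigD1 a) //= [X in _ + X]big1 ?addn0.
  by apply: eq_bigr => i _; rewrite eqxx !mul0n !addn0 !mul1n.
by move=> c /negPf nca; rewrite big1 // => i _; rewrite nca.
Qed.

(* Vandermonde's convolution: prepending [o] is the operator [1 + S], with [S]
   an isometry for the Gram form. *)
Lemma gram_one K e e' : size e <= K ->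
  gram K.+1 (o :: e) (o :: e')
  = gram K.+1 (o :: e) e' + gram K.+1 e (o :: e').
Proof.
move=> leK.
(* The isometry: [S] moves a vector onto the words starting with [o]. *)
have shift : \sum_(b : T) \sum_(i <- words K)
    ((b == o) * deletions e i) * ((b == o) * deletions e' i)
    = gram K.+1 e e'.
  rewrite gram_widen // (bigD1 o) //= [X in _ + X]big1 ?addn0.
    by apply: eq_bigr => i _; rewrite eqxx !mul1n.
  by move=> c /negPf nca; rewrite big1 // => i _; rewrite nca.
(* [A] stands for [S] and [B] for the identity; the product of the [B] terms is added on the left to
   avoid subtraction in [nat]. *)
have split_sum (A B A' B' : T -> seq T -> nat) :
    \sum_b \sum_(i <- words K) (A b i + B b i) * (A' b i + B' b i)
    + \sum_b \sum_(i <- words K) B b i * B' b i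
    = \sum_b \sum_(i <- words K) (A b i + B b i) * B' b i
      + \sum_b \sum_(i <- words K) B b i * (A' b i + B' b i)
      + \sum_b \sum_(i <- words K) A b i * A' b i.
  rewrite -!big_split /=; apply: eq_bigr => b _.
  by rewrite -!big_split /=; apply: eq_bigr => i _; lia.
move: shift; rewrite /gram !big_wordsS /= eqxx !mul1n.
under [X in _ -> _ + X = _]eq_bigr do under eq_bigr do rewrite !mul1n.
under [X in _ -> _ = _ + X + _]eq_bigr do under eq_bigr do rewrite !mul1n.
under [X in _ -> _ = _ + (_ + X)]eq_bigr do under eq_bigr do rewrite !mul1n.
have := split_sum (fun b i => (b == o) * deletions e i)
  (fun b i => deletions e (b :: i)) (fun b i => (b == o) * deletions e' i)
  (fun b i => deletions e' (b :: i)).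
lia.
Qed.

(** At this extremal [m] only letters other than [o] are matched, and both sides satisfy the same
    recursion on the leading letters. *)
Lemma overlaps_gram m K e e' : size e <= K -> size e' <= K ->
  nonones e = nonones e' -> m + nonones e = size e + size e' ->
  overlaps m e e' = gram K e e'.
Proof.
elim: m K e e' => [|m IHm] K [|a e] [|b e'] //=;
  rewrite ?nonones_cons ?nonones_nil ?gram_nil //.
- by move=> _ _ ->.
- move=> _ _ _; have := nonones_size e.
  by case: (a != o); lia.
- have [->|nbo] := eqVneq b o; last by [].
  move=> _ ltK eqr eqm; rewrite mul1n gramC gram_one_nil // gramC.
  by apply: IHm; rewrite ?nonones_nil /=; lia.
- have [->|nao] := eqVneq a o; last by [].
  move=> ltK _ eqr eqm; rewrite mul1n gram_one_nil //.
  by apply: IHm; rewrite ?nonones_nil /=; lia.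
case: K => // K; rewrite !ltnS => leK leK'.
have [->|nao] := eqVneq a o; have [->|nbo] := eqVneq b o;
  rewrite ?eqxx ?nao ?nbo /= => eqr eqm;
  rewrite ?mul1n ?mul0n ?add0n ?addn0.
(* Matching the two leading [o] would leave too many points for the remaining letters to cover. *)
- rewrite (overlaps_eq0 (e := e) (e' := e')) ?addn0; last by lia.
  rewrite gram_one //.
  by congr addn; apply: IHm; rewrite ?nonones_cons ?eqxx /=; lia.
- rewrite gram_one_neq //.
  by apply: IHm; rewrite ?nonones_cons ?nbo /=; lia.
- rewrite (negPf nao) mul0n addn0 gramC gram_one_neq // gramC.
  by apply: IHm; rewrite ?nonones_cons ?nao /=; lia.
- have [eqab|nab] := eqVneq a b.
    by rewrite -eqab mul1n gram_neq //; apply: IHm; lia.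
  (* A contributing [i] would have to start both with [a] and with [b]. *)
  rewrite mul0n /gram big_wordsS /= (negPf nao) mul0n add0n big1 // => c _.
  rewrite big1 // => i _; rewrite (negPf nbo) !addn0.
  have [->|_] := eqVneq c a; last by [].
  by rewrite (negPf nab) mul0n muln0.
Qed.
End Overlaps.

Local Open Scope ring_scope.
Local Open Scope classical_set_scope.

(** * Recursions in the length of the random word *)

Lemma big_tupleS (V : nmodType) (A : finType) (n : nat)
    (F : n.+1.-tuple A -> V) :
  \sum_(t : n.+1.-tuple A) F t
  = \sum_(x : A) \sum_(t : n.-tuple A) F [tuple of x :: t].
Proof.
rewrite pair_big /= (reindex (fun q : A * n.-tuple A => [tuple of q.1 :: q.2])).
  by [].
exists (fun t : n.+1.-tuple A => (thead t, [tuple of behead t])) => [[x t]|t] _.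
  by congr pair; apply: val_inj.
by rewrite /= -tuple_eta.
Qed.

(** Independence of the first letter. [X] lives on sequences so that it can be evaluated at words of
    every length. *)
Lemma expectS (R : realType) (Sigma : finType) (p : Sigma -> R) (n : nat)
    (X : seq Sigma -> R) :
  expect p (fun w : n.+1.-tuple Sigma => X w)
  = \sum_x p x * expect p (fun w : n.-tuple Sigma => X (x :: w)).
Proof.
rewrite /expect big_tupleS; apply: eq_bigr => x _.
rewrite mulr_sumr; apply: eq_bigr => w _; rewrite mulrA; congr (_ * _).
by rewrite /word_prob big_ord_recl; congr (_ * _); apply: eq_bigr => i _;
  rewrite tnthS.
Qed.

Lemma expect0 (R : realType) (Sigma : finType) (p : Sigma -> R)
    (X : seq Sigma -> R) :
  expect p (fun w : 0.-tuple Sigma => X w) = X [::].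
Proof.
rewrite /expect (big_pred1 [tuple]) => [|w]; last first.
  by apply/esym/eqP; exact: tuple0.
by rewrite /word_prob big_ord0 mul1r.
Qed.

(** Pascal's rule, which lets binomial sums solve the recursion for the second moments. *)
Lemma binomial_sumS (n : nat) (P : nat -> nat) :
  (\sum_(m < n.+2) 'C(n.+1, m) * P m
  = \sum_(m < n.+1) 'C(n, m) * P m + \sum_(m < n.+1) 'C(n, m) * P m.+1)%N.
Proof.
rewrite big_ord_recl /= bin0.
under eq_bigr do rewrite /bump /= binS mulnDl.
rewrite big_split /= addnA; congr addn.
rewrite [in LHS]big_ord_recr /= bin_small // mul0n addn0.
by rewrite [in RHS]big_ord_recl /= bin0.
Qed.

(** * Second moments of subword sums *)

Section SubwordSums.
Variables (R : realType) (Sigma : finType) (p : Sigma -> R).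
Variables (T : finType) (o : T) (h : T -> Sigma -> R).
Hypothesis p_sum : \sum_x p x = 1.
Hypothesis h_orth : forall a b, \sum_x p x * h a x * h b x = (a == b)%:R.
Hypothesis h_one : forall x, h o x = 1.
Implicit Types e : seq T.

(* Sum of [\prod_i h e_i w_(t_i)] over the increasing sequences of positions [t]. *)
Fixpoint subword_sum e (w : seq Sigma) {struct w} : R :=
  match e, w with
  | [::], _ => 1
  | _ :: _, [::] => 0
  | a :: e1, x :: w1 => subword_sum e w1 + h a x * subword_sum e1 w1
  end.

Lemma subword_sum_nil w : subword_sum [::] w = 1.
Proof. by case: w. Qed.

Lemma mean_letter a : \sum_x p x * h a x = (a == o)%:R.
Proof.
by rewrite -h_orth; apply: eq_bigr => x _; rewrite h_one mulr1.
Qed.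

Lemma expectD n (X Y : n.-tuple Sigma -> R) :
  expect p (fun w => X w + Y w) = expect p X + expect p Y.
Proof. by rewrite /expect -big_split /=; apply: eq_bigr => w _; rewrite mulrDr. Qed.

Lemma expectZ n c (X : n.-tuple Sigma -> R) :
  expect p (fun w => c * X w) = c * expect p X.
Proof. by rewrite /expect mulr_sumr; apply: eq_bigr => w _; rewrite mulrCA. Qed.

Lemma expect_sum n (I : finType) (X : I -> n.-tuple Sigma -> R) :
  expect p (fun w => \sum_i X i w) = \sum_i expect p (X i).
Proof.
rewrite /expect exchange_big /=; apply: eq_bigr => w _.
by rewrite mulr_sumr.
Qed.

Lemma eq_expect n (X Y : n.-tuple Sigma -> R) : X =1 Y ->
  expect p X = expect p Y.
Proof. by move=> eqXY; apply: eq_bigr => w _; rewrite eqXY. Qed.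

(** Condition on the first letter of [w]. If neither word uses it, [m] is unchanged; if one or both
    do, [mean_letter] and [h_orth] produce the terms in the recursion of [overlaps] at [m.+1]. *)
Lemma expect_subword_sum n e e' :
  expect p (fun w : n.-tuple Sigma => subword_sum e w * subword_sum e' w)
  = (\sum_(m < n.+1) 'C(n, m) * overlaps o m e e')%N%:R.
Proof.
elim: n e e' => [|n IHn] e e'.
  rewrite (expect0 p (fun w => subword_sum e w * subword_sum e' w)).
  by rewrite big_ord1 bin0 mul1n; case: e e' => [|a e] [|b e'] /=;
    rewrite ?(mulr0, mul0r, mul1r).
rewrite (expectS p n (fun w => subword_sum e w * subword_sum e' w)).
rewrite (binomial_sumS n (fun m => overlaps o m e e')) natrD.
case: e e' => [|a e] [|b e'].
- rewrite [X in _ = _ + X%:R]big1 ?addr0 => [|m _]; last by rewrite muln0.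
  rewrite -IHn -[RHS]mul1r -p_sum mulr_suml; apply: eq_bigr => x _.
  by congr (_ * _); apply: eq_expect => w; rewrite /= subword_sum_nil.
- transitivity (\sum_x (p x * expect p (fun w : n.-tuple Sigma =>
      subword_sum [::] w * subword_sum (b :: e') w)
    + p x * h b x * expect p (fun w : n.-tuple Sigma =>
      subword_sum [::] w * subword_sum e' w))).
    apply: eq_bigr => x _; rewrite -mulrA -mulrDr -(expectZ (h b x)) -expectD.
    by congr (_ * _); apply: eq_expect => w /=; rewrite subword_sum_nil; ring.
  rewrite big_split /= -!mulr_suml p_sum mul1r mean_letter !IHn -natrM.
  congr (_ + _%:R); rewrite big_distrr /=; apply: eq_bigr => m _.
  by rewrite mulnCA.
- transitivity (\sum_x (p x * expect p (fun w : n.-tuple Sigma =>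
      subword_sum (a :: e) w * subword_sum [::] w)
    + p x * h a x * expect p (fun w : n.-tuple Sigma =>
      subword_sum e w * subword_sum [::] w))).
    apply: eq_bigr => x _; rewrite -mulrA -mulrDr -(expectZ (h a x)) -expectD.
    by congr (_ * _); apply: eq_expect => w /=; rewrite subword_sum_nil; ring.
  rewrite big_split /= -!mulr_suml p_sum mul1r mean_letter !IHn -natrM.
  congr (_ + _%:R); rewrite big_distrr /=; apply: eq_bigr => m _.
  by rewrite mulnCA.
- transitivity (\sum_x (p x * expect p (fun w : n.-tuple Sigma =>
      subword_sum (a :: e) w * subword_sum (b :: e') w)
    + (p x * h b x * expect p (fun w : n.-tuple Sigma =>
      subword_sum (a :: e) w * subword_sum e' w)
    + p x * h a x * expect p (fun w : n.-tuple Sigma =>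
      subword_sum e w * subword_sum (b :: e') w)
    + p x * h a x * h b x * expect p (fun w : n.-tuple Sigma =>
      subword_sum e w * subword_sum e' w)))).
    apply: eq_bigr => x _; rewrite -!mulrA -!mulrDr.
    rewrite -!(expectZ (h b x)) -!(expectZ (h a x)) -!expectD.
    by congr (_ * _); apply: eq_expect => w /=; ring.
  rewrite !big_split /= -!mulr_suml p_sum mul1r !mean_letter h_orth !IHn.
  rewrite -!natrM -!natrD; congr _%:R; congr addn.
  rewrite !big_distrr -!big_split /=; apply: eq_bigr => m _.
  lia.
Qed.
End SubwordSums.

Lemma zip_mapr (A B C : Type) (f : B -> C) (s : seq A) (t : seq B) :
  zip s (map f t) = [seq (q.1, f q.2) | q <- zip s t].
Proof. by elim: s t => [|x s IHs] [|y t] //=; rewrite IHs. Qed.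

(** * Enumeration of increasing position sequences *)

Section Positions.

(** The split according to whether position 0 is used mirrors the recursion of [subword_sum]. *)
Fixpoint increasing_seqs (k n : nat) {struct n} : seq (seq nat) :=
  match k, n with
  | 0, _ => [:: [::]]
  | _.+1, 0 => [::]
  | k'.+1, n'.+1 => [seq 0%N :: map S s | s <- increasing_seqs k' n']
                    ++ [seq map S s | s <- increasing_seqs k n']
  end.

Lemma increasing_seqs_uniq k n : uniq (increasing_seqs k n).
Proof.
elim: n k => [|n IHn] [|k] //=.
have S_inj : injective (map S) by apply: inj_map; apply: succn_inj.
rewrite cat_uniq !map_inj_uniq ?IHn //= => [|s t [/S_inj//]].
rewrite andbT; apply/hasPn => _ /mapP[s _ ->].
by apply/mapP => -[t _]; case: s.
Qed.

Lemma mem_increasing_seqs k n (s : seq nat) :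
  (s \in increasing_seqs k n) = [&& size s == k, sorted ltn s & all (gtn n) s].
Proof.
have S_inj : injective (map S) by apply: inj_map; apply: succn_inj.
have sortedS t : sorted ltn (map S t) = sorted ltn t.
  by rewrite sorted_map; apply: eq_sorted.
have allS m t : all (gtn m.+1) (map S t) = all (gtn m) t.
  by rewrite all_map; apply: eq_all.
have mapS_pred t : all (ltn 0) t -> t = map S (map predn t).
  move=> /allP t_gt0; rewrite -map_comp -[LHS]map_id; apply/eq_in_map => x /t_gt0.
  by move=> x_gt0 /=; rewrite prednK.
elim: n k s => [|n IHn] [|k] s.
- by rewrite inE; case: s.
- by case: s => [|x s] //; rewrite in_nil /= !andbF.
- by rewrite inE; case: s.
rewrite /= mem_cat; case: s => [|x s].
  by apply/negbTE; rewrite negb_or; apply/andP; split; apply/mapP=> -[t];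
    rewrite ?IHn; case: t.
(* A 0 in the tail is impossible on both sides: enumerated tails are shifted by [S], and sortedness
   puts tail entries above the head. *)
have [s_gt0|s_eq0] := boolP (all (ltn 0) s); last first.
  have map_gt0 t : s = map S t -> all (ltn 0) s.
    by move=> ->; rewrite all_map; apply/allP.
  rewrite [LHS](_ : _ = false); last first.
    apply/negbTE; rewrite negb_or; apply/andP.
    split; apply/mapP => -[t _]; first by case=> _ /map_gt0; apply/negP.
    by case: t => // y t [_ /map_gt0]; apply/negP.
  apply/esym/negbTE; apply: contra s_eq0 => /and3P[_ + _] /=.
  rewrite /= (path_sortedE ltn_trans).
  by case/andP=> /allP lt_s _; apply/allP => y /lt_s; apply: leq_ltn_trans.
rewrite (mapS_pred s s_gt0); set t := map predn s.
case: x => [|x].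
  rewrite (mem_map (f := fun t => 0%N :: map S t)) => [|u u' [/S_inj//]].
  rewrite [X in _ || X](_ : _ = false) ?orbF.
    rewrite IHn /= size_map allS (path_sortedE ltn_trans).
    by rewrite sortedS -mapS_pred // [all _ s]s_gt0.
  by apply/mapP => -[[|y u] _].
rewrite [X in X || _](_ : _ = false); last by apply/mapP => -[].
rewrite -[x.+1 :: _]/(map S (x :: t)) (mem_map S_inj) IHn.
by rewrite sortedS allS size_map.
Qed.

Lemma sum_increasing (V : nmodType) (k n : nat) (F : seq nat -> V) :
  \sum_(t : k.-tuple 'I_n | sorted ltn (map val t)) F (map val t)
  = \sum_(s <- increasing_seqs k n) F s.
Proof.
rewrite -(big_map (fun t : k.-tuple 'I_n => map val t) (sorted ltn) F).
rewrite -big_filter; apply: perm_big; apply: uniq_perm.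
- apply: filter_uniq; rewrite map_inj_uniq ?index_enum_uniq // => t u eq_tu.
  by apply: val_inj; apply: inj_map eq_tu; apply: val_inj.
- exact: increasing_seqs_uniq.
move=> s; rewrite mem_filter mem_increasing_seqs andbCA; congr andb.
apply/mapP/andP => [[t _ ->]|[/eqP sz_s lt_s]].
  rewrite size_map size_tuple; split=> //.
  by rewrite all_map; apply/allP => i _ /=; apply: ltn_ord.
(* No entry is dropped by [pmap], as all are below [n]; this yields the preimage tuple. *)
have eq_s : map val (pmap (insub : nat -> option 'I_n) s) = s.
  rewrite (pmap_filter (insubK _)) -[RHS]filter_predT.
  apply: eq_in_filter => x /(allP lt_s) /= ltx.
  by rewrite isSome_insub.
have sz : size (pmap (insub : nat -> option 'I_n) s) == k.
  by rewrite -(size_map val) eq_s sz_s.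
by exists (Tuple sz); rewrite ?mem_index_enum.
Qed.
End Positions.

(** * Occurrence counts as subword sums *)

Section Occurrences.
Variables (R : realType) (Sigma : finType) (T : finType) (h : T -> Sigma -> R).

(** The default [x0] is never read, since all positions are below [size w]. *)
Lemma subword_sum_increasing (x0 : Sigma) (e : seq T) (w : seq Sigma) :
  \sum_(s <- increasing_seqs (size e) (size w))
     \prod_(q <- zip e s) h q.1 (nth x0 w q.2)
  = subword_sum h e w.
Proof.
elim: w e => [|x w IHw] [|a e] /=; rewrite ?big_nil ?big_seq1 ?big_nil //.
rewrite big_cat /= !big_map addrC -IHw -IHw mulr_sumr; congr (_ + _).
  apply: eq_bigr => -[|i s] _; rewrite ?big_nil // /= !big_cons /=.
  by rewrite zip_mapr big_map.
apply: eq_bigr => s _; rewrite /= big_cons /=.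
by rewrite zip_mapr big_map.
Qed.

(** Double counting of pairs of a word and a position sequence: each increasing [t] spells exactly
    one word in [w]. *)
Lemma sum_occ (k n : nat) (F : k.-tuple Sigma -> R) (w : n.-tuple Sigma) :
  \sum_(u : k.-tuple Sigma) F u * (occ u w)%:R
  = \sum_(t : k.-tuple 'I_n | sorted ltn (map val t))
      F [tuple tnth w (tnth t i) | i < k].
Proof.
have incrE (t : k.-tuple 'I_n) :
    [forall i : 'I_k, forall j : 'I_k, (i < j)%N ==> (tnth t i < tnth t j)%N]
    = sorted ltn (map val t).
  rewrite (sorted_pairwise ltn_trans); apply/idP/(pairwiseP 0%N).
    move=> /'forall_'forall_implyP incr i j; rewrite !inE size_map size_tuple.
    move=> ltik ltjk ltij.
    have := incr (Ordinal ltik) (Ordinal ltjk) ltij.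
    by rewrite -!(tnth_map val) !(tnth_nth 0%N).
  move=> incr; apply/'forall_'forall_implyP => i j ltij.
  rewrite -!(tnth_map val) !(tnth_nth 0%N); apply: incr => //;
    by rewrite inE size_map size_tuple.
under eq_bigr => u _.
  rewrite /occ -sum1_card natr_sum mulr_sumr.
  under eq_bigl => t do rewrite inE incrE.
  rewrite big_mkcondr /=.
over.
rewrite exchange_big /=; apply: eq_bigr => t incr_t.
rewrite (bigD1 [tuple tnth w (tnth t i) | i < k]) //= big1 ?addr0.
  rewrite ifT ?mulr1 //; apply/forallP => i.
  by rewrite tnth_mktuple.
move=> u neq_u; rewrite ifN //; apply: contra neq_u => /forallP eq_u.
by apply/eqP/eq_from_tnth => i; rewrite tnth_mktuple (eqP (eq_u i)).
Qed.

Lemma sum_prod_occ (x0 : Sigma) (k n : nat) (e : k.-tuple T) (w : n.-tuple Sigma) :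
  \sum_(u : k.-tuple Sigma) (\prod_(i < k) h (tnth e i) (tnth u i)) * (occ u w)%:R
  = subword_sum h e w.
Proof.
rewrite sum_occ -(subword_sum_increasing x0) !size_tuple -sum_increasing.
apply: eq_bigr => t _.
have := big_tuple 1 *%R (zip_tuple e t) xpredT (fun q => h q.1 (tnth w q.2)).
rewrite /= -[X in _ = X -> _]/(\prod_(i < k) _).
rewrite zip_mapr big_map /=.
under [X in _ -> _ = X]eq_bigr do rewrite -tnth_nth.
move=> ->; apply: eq_bigr => i _.
by rewrite tnth_mktuple !(tnth_nth (tnth e i, tnth t i)) /= nth_zip ?size_tuple //=
  -!tnth_nth.
Qed.
End Occurrences.

(** * Asymptotics of binomial coefficients *)

Section Limits.
Variable R : realType.

Lemma cvg_natV : (fun n => n%:R^-1 : R) @ \oo --> (0 : R).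
Proof. by rewrite -cvg_shiftS; apply: cvg_harmonic. Qed.

Lemma cvg_sumr (I : finType) (u : I -> nat -> R) (l : I -> R) :
  (forall i, u i @ \oo --> l i) ->
  (fun n => \sum_i u i n) @ \oo --> \sum_i l i.
Proof.
by move=> ul; apply: cvg_big => [|i _]; [exact: add_continuous|exact: ul].
Qed.

(** Passing from [m] to [m.+1] multiplies the quotient by [(1 - m / n) / (m + 1)]. *)
Lemma cvg_bin m :
  (fun n => 'C(n, m)%:R / n%:R ^+ m : R) @ \oo --> (m`!%:R : R)^-1.
Proof.
elim: m => [|m IHm].
  under eq_fun do rewrite bin0 expr0 divr1.
  by rewrite fact0 invr1; apply: cvg_cst.
have lim1 : (fun n => 1 - m%:R * n%:R^-1 : R) @ \oo --> (1 - m%:R * 0 : R).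
  by apply: cvgB; [exact: cvg_cst|apply: cvgMl_tmp; exact: cvg_natV].
have : (fun n => 'C(n, m)%:R / n%:R ^+ m * (1 - m%:R * n%:R^-1) * m.+1%:R^-1 : R)
    @ \oo --> ((m`!%:R)^-1 * (1 - m%:R * 0) * m.+1%:R^-1 : R).
  by apply: cvgM; [exact: cvgM | exact: cvg_cst].
rewrite mulr0 subr0 mulr1 -invfM -natrM mulnC -factS.
apply: cvg_trans; apply: near_eq_cvg; near=> n.
have n0 : (n%:R : R) != 0 by rewrite pnatr_eq0 -lt0n; near: n; exists 1%N.
have lemn : (m <= n)%N by near: n; exists m.
have m0 : (m.+1%:R : R) != 0 by rewrite pnatr_eq0.
have /(congr1 (fun j => j%:R : R)) := mul_bin_left n m.
rewrite !natrM natrB // => eqC.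
apply: (mulfI m0); rewrite [RHS]mulrA eqC exprS; field.
by rewrite expf_neq0 // n0 nat1r.
Unshelve. all: by end_near. Qed.

(** Normalizing each binomial by its power of [n] leaves the factor [n ^ (- d)] with
    [d = 2k - m - r], which tends to 1 if [d = 0] and to 0 otherwise. *)
Lemma cvg_bin_ratio k r m : (m + r <= k + k)%N ->
  (fun n => n%:R ^+ r * 'C(n, m)%:R / 'C(n, k)%:R ^+ 2 : R) @ \oo -->
  (if (m + r == k + k)%N then k`!%:R ^+ 2 / m`!%:R else 0 : R).
Proof.
move=> le_mr; set d := (k + k - (m + r))%N.
have eqd : (k + k = m + r + d)%N by rewrite /d subnKC.
have limd : (fun n => n%:R^-1 ^+ d : R) @ \oo --> ((m + r == k + k)%N%:R : R).
  rewrite eqd -[X in X == _]addn0 eqn_add2l eq_sym; elim: (d) => [|d' IHd].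
    by rewrite eqxx; apply: cvg_cst.
  rewrite /= -[X in _ --> X](mul0r (d' == 0)%N%:R).
  under eq_fun do rewrite exprS.
  by apply: cvgM => //; exact: cvg_natV.
have limk : (fun n => ('C(n, k)%:R / n%:R ^+ k)^-1 : R) @ \oo --> (k`!%:R : R).
  rewrite -[X in _ --> X]invrK; apply: cvgV; last exact: cvg_bin.
  by rewrite invr_eq0 pnatr_eq0 -lt0n fact_gt0.
have : (fun n => 'C(n, m)%:R / n%:R ^+ m *
      (('C(n, k)%:R / n%:R ^+ k)^-1 * ('C(n, k)%:R / n%:R ^+ k)^-1) *
      n%:R^-1 ^+ d : R) @ \oo -->
    ((m`!%:R)^-1 * (k`!%:R * k`!%:R) * (m + r == k + k)%N%:R : R).
  by apply: cvgM => //; apply: cvgM; [exact: cvg_bin | exact: cvgM].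
rewrite -expr2 [_^-1 * _]mulrC.
have -> : (if (m + r == k + k)%N then k`!%:R ^+ 2 / m`!%:R else 0 : R)
  = k`!%:R ^+ 2 / m`!%:R * (m + r == k + k)%N%:R.
  by case: ifP; rewrite ?mulr1 ?mulr0.
apply: cvg_trans; apply: near_eq_cvg; near=> n.
have n0 : (n%:R : R) != 0 by rewrite pnatr_eq0 -lt0n; near: n; exists 1%N.
rewrite /= -invfM -expr2 expr_div_n invf_div -exprM muln2 -addnn eqd.
rewrite !exprD exprVn; set x := (_ ^+ 2)^-1.
by field; rewrite !expf_neq0.
Unshelve. all: by end_near. Qed.
End Limits.

(** Serves to replace a range growing with [n] by a fixed one, so that limits can be taken term by
    term. *)
Lemma big_ord_support (n M : nat) (F : nat -> nat) :
  (forall m, (n < m)%N -> F m = 0%N) -> (forall m, (M < m)%N -> F m = 0%N) ->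
  (\sum_(m < n.+1) F m = \sum_(m < M.+1) F m)%N.
Proof.
have widen a b : (a <= b)%N -> (forall m, (a < m)%N -> F m = 0%N) ->
    (\sum_(m < a.+1) F m = \sum_(m < b.+1) F m)%N.
  move=> leab F0; rewrite -!(big_mkord xpredT F).
  rewrite [RHS](@big_cat_nat _ _ _ a.+1) //= [X in _ = (_ + X)%N]big_nat.
  by rewrite [X in _ = (_ + X)%N]big1 ?addn0 // => m /andP[ltam _]; apply: F0.
by move=> Fn FM; case/orP: (leq_total n M) => le; [|symmetry]; apply: widen.
Qed.

(** * Expansion in words over the orthonormal basis *)

Section Expansion.
Variables (R : realType) (Sigma : finType) (p : Sigma -> R).
Variable D : #|Sigma|.-tuple (W R Sigma 1).

Definition basis_letter (a : 'I_#|Sigma|) (x : Sigma) : R :=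
  coef (tnth D a) [tuple x].

Definition basis_word k (e : k.-tuple 'I_#|Sigma|) : W R Sigma k :=
  concat (fun i => tnth D (tnth e i)).

Lemma coef_sum (I : finType) k (c : I -> R) (g : I -> W R Sigma k) u :
  coef (\sum_i c i *: g i) u = \sum_i c i * coef (g i) u.
Proof. by rewrite /coef sum_ffunE; apply: eq_bigr => i _; rewrite ffunE. Qed.

Lemma coef_word k (v u : k.-tuple Sigma) :
  coef (word R v) u = (u == v)%:R.
Proof. by rewrite /coef ffunE. Qed.

Lemma coef_basis_word k (e : k.-tuple 'I_#|Sigma|) u :
  coef (basis_word e) u = \prod_(i < k) basis_letter (tnth e i) (tnth u i).
Proof.
rewrite /basis_word /concat coef_sum (bigD1 u) //= coef_word (eqxx u) mulr1.
rewrite [X in _ + X]big1 ?addr0 // => v neq.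
by rewrite coef_word eq_sym (negPf neq) mulr0.
Qed.

Lemma coef_one_letter x : coef (one_letter R Sigma) [tuple x] = 1.
Proof.
have -> : one_letter R Sigma = \sum_y 1 *: word R [tuple y].
  by apply: eq_bigr => y _; rewrite scale1r.
rewrite coef_sum (bigD1 x) //= coef_word (eqxx [tuple x]) mulr1.
rewrite big1 ?addr0 // => y neq; rewrite coef_word mul1r.
by case: eqP => // -[eq_xy]; rewrite eq_xy eqxx in neq.
Qed.

Lemma inner1E (g g' : W R Sigma 1) :
  inner p g g' = \sum_x p x * coef g [tuple x] * coef g' [tuple x].
Proof.
rewrite /inner big_tupleS; apply: eq_bigr => x _.
rewrite (big_pred1 [tuple]) => [|w]; last by apply/esym/eqP; exact: tuple0.
have -> : [tuple of x :: [tuple]] = [tuple x] by apply: val_inj.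
by rewrite /word_prob big_ord1.
Qed.

Lemma density_sum k n (phi : k.-tuple 'I_#|Sigma| -> R) (x0 : Sigma)
    (w : n.-tuple Sigma) :
  density (\sum_e phi e *: basis_word e) w
  = (\sum_e phi e * subword_sum basis_letter e w) / 'C(n, k)%:R.
Proof.
rewrite /density mulr_suml.
under eq_bigr do rewrite coef_sum /occ_density mulr_suml.
rewrite exchange_big /=; apply: eq_bigr => e _.
rewrite -(sum_prod_occ _ x0) mulr_sumr mulr_suml; apply: eq_bigr => u _.
by rewrite coef_basis_word !mulrA.
Qed.

(** The span is a sum of lines, which gives one coefficient per spanning word; extension by 0 to all
    words turns membership into a support condition on [phi]. *)
Lemma Wkr_sum k r f (o : 'I_#|Sigma|) :
  (forall a, (tnth D a == one_letter R Sigma) = (a == o)) ->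
  (r <= k)%N -> f \in Wkr D k r ->
  exists phi : k.-tuple 'I_#|Sigma| -> R,
    (forall e, phi e != 0 -> nonones o e = r) /\
    f = \sum_e phi e *: basis_word e.
Proof.
move=> DoE lerk; rewrite /Wkr span_def big_image /=.
case/memv_sumP => v v_in ->.
have /choice[c vE] e : exists c : R, e \in
    [pred e : k.-tuple 'I_#|Sigma| |
        #|[set i : 'I_k | tnth D (tnth e i) == one_letter R Sigma]%SET|
          == (k - r)%N] -> v e = c *: basis_word e.
  have [e_in|_] := boolP (e \in _); last by exists 0.
  by have /vlineP[c vE] := v_in e e_in; exists c.
exists (fun e => if #|[set i : 'I_k | tnth D (tnth e i) == one_letter R Sigma]%SET|
          == (k - r)%N then c e else 0); split.
  move=> e; case: ifP => [/eqP card_e _|]; last by rewrite eqxx.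
  have := count_predC (pred1 o) e; rewrite size_tuple.
  have -> : count (pred1 o) e = (k - r)%N.
    rewrite -card_e -sum1_count big_tuple -sum1_card.
    by apply: eq_bigl => i; rewrite inE DoE.
  have -> : count (predC (pred1 o)) e = nonones o e by apply: eq_count.
  by move=> eqk; apply: (@addnI (k - r)%N); rewrite eqk subnK.
rewrite big_mkcond /=; apply: eq_bigr => e _.
by rewrite inE; case: ifP => [/vE|_]; rewrite ?scale0r.
Qed.

Hypothesis p_sum : \sum_x p x = 1.
Variable o : 'I_#|Sigma|.
Hypothesis orth :
  forall a b, \sum_x p x * basis_letter a x * basis_letter b x = (a == b)%:R.
Hypothesis one : forall x, basis_letter o x = 1.

Lemma expect_density_mul k n (phi phi' : k.-tuple 'I_#|Sigma| -> R)
    (x0 : Sigma) :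
  expect p (fun w : n.-tuple Sigma =>
    density (\sum_e phi e *: basis_word e) w
    * density (\sum_e phi' e *: basis_word e) w)
  = \sum_e \sum_e' phi e * phi' e' *
      ((\sum_(m < n.+1) 'C(n, m) * overlaps o m e e')%N%:R / 'C(n, k)%:R ^+ 2).
Proof.
transitivity (expect p (fun w : n.-tuple Sigma => \sum_e \sum_e'
    (phi e * phi' e' / 'C(n, k)%:R ^+ 2) *
    (subword_sum basis_letter e w * subword_sum basis_letter e' w))).
  apply: eq_expect => w; rewrite !(density_sum _ x0) mulrACA -invfM -expr2.
  rewrite big_distrlr /= mulr_suml; apply: eq_bigr => e _.
  by rewrite mulr_suml; apply: eq_bigr => e' _; rewrite mulrACA mulrAC.
rewrite expect_sum; apply: eq_bigr => e _.
rewrite expect_sum; apply: eq_bigr => e' _.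
by rewrite expectZ (expect_subword_sum p_sum orth one) mulrAC mulrA.
Qed.
End Expansion.

(** * Positivity of the limit form, orthogonality and convergence *)

Lemma gram_form_gt0 (R : realDomainType) (T : finType) (o : T) (k : nat)
    (phi : k.-tuple T -> R) (e0 : k.-tuple T) : phi e0 != 0 ->
  0 < \sum_e \sum_e' phi e * phi e' * (gram o k e e')%:R.
Proof.
move=> phi0.
(* A Gram form is a sum of squares, one for each word [i]. *)
have -> : \sum_e \sum_e' phi e * phi e' * (gram o k e e')%:R
    = \sum_(i <- words T k) (\sum_e phi e * (deletions o e i)%:R) ^+ 2.
  under [RHS]eq_bigr do rewrite expr2 big_distrlr /=.
  rewrite [RHS]exchange_big /=; apply: eq_bigr => e _.
  rewrite [RHS]exchange_big /=; apply: eq_bigr => e' _.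
  rewrite natr_sum mulr_sumr; apply: eq_bigr => i _.
  by rewrite natrM mulrACA.
(* The square at [i = e0] is [phi e0 ^+ 2], since no other word of length [k] reduces to [e0]. *)
have e0_in : val e0 \in words T k by apply: mem_words; rewrite size_tuple.
rewrite (big_rem _ e0_in) /= ltr_wpDr //.
  by apply: sumr_ge0 => i _; apply: sqr_ge0.
rewrite (bigD1 e0) //= deletions_same_size // eqxx mulr1 big1 ?addr0.
  by rewrite lt0r sqr_ge0 sqrf_eq0 phi0.
move=> e neq; rewrite deletions_same_size ?size_tuple //.
by rewrite (negPf (neq : val e != val e0)) mulr0.
Qed.

Theorem theorem1 (R : realType) (Sigma : finType) (p : Sigma -> R)
  (D : #|Sigma|.-tuple (W R Sigma 1)) (k r : nat) (f : W R Sigma k) :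
  (2 <= #|Sigma|)%N ->
  is_letter_distr p ->
  is_orthonormal_basis_with_one p D ->
  (r <= k)%N ->
  f \in Wkr D k r ->
  f != 0 ->
  (exists C : R, 0 < C /\
     (fun n : nat =>
        n%:R ^+ r * expect p (fun w : n.-tuple Sigma => density f w ^+ 2))
       @ \oo --> C) /\
  (forall (r' : nat) (f' : W R Sigma k),
     (r' <= k)%N -> r' != r -> f' \in Wkr D k r' ->
     forall n : nat, (k <= n)%N ->
       expect p (fun w : n.-tuple Sigma => density f w * density f' w) = 0).
Proof.
move=> card2 [_ p_sum] [one_in orthD _] lerk f_in f0.
have /card_gt0P[x0 _] : (0 < #|Sigma|)%N by exact: leq_trans card2.
have orth a b :
    \sum_x p x * basis_letter D a x * basis_letter D b x = (a == b)%:R.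
  by rewrite -orthD inner1E.
case/tnthP: (one_in) => o oE.
(* Orthonormality excludes a second occurrence of the letter 1 in [D]. *)
have DoE (a : 'I_#|Sigma|) : (tnth D a == one_letter R Sigma) = (a == o).
  apply/eqP/eqP => [eq_a|->]; last by rewrite oE.
  have := orthD a o; rewrite eq_a -oE [in LHS]oE orthD eqxx.
  by case: eqP => // _ /eqP; rewrite oner_eq0.
have one x : basis_letter D o x = 1.
  by rewrite /basis_letter -oE coef_one_letter.
have [phi [phi_r fE]] := Wkr_sum DoE lerk f_in.
split; last first.
  move=> r' f' lerk' neq_r /(Wkr_sum DoE lerk')[phi' [phi_r' ->]] n _.
  rewrite fE (expect_density_mul p_sum orth one) // big1 // => e _.
  rewrite big1 // => e' _.
  have [->|/phi_r re] := eqVneq (phi e) 0; first by rewrite !mul0r.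
  have [->|/phi_r' re'] := eqVneq (phi' e') 0; first by rewrite mulr0 mul0r.
  (* Words with different numbers of letters other than 1 have no overlaps, so every term vanishes
     at each [n]. *)
  rewrite big1 ?mul0r ?mulr0 // => m _; have [->|] := eqVneq (overlaps o m e e') 0%N.
    by rewrite muln0.
  by case/overlaps_neq0; rewrite re re' => eq_r; rewrite eq_r eqxx in neq_r.
have [e0 phi0] : exists e0, phi e0 != 0.
  apply/not_existsP => phi0; move/eqP: f0; apply; rewrite fE big1 // => e _.
  by have /negP/negPn/eqP-> := phi0 e; rewrite scale0r.
(* [M] is the largest possible number of points in an overlap, and [c] is the limit of
   [n ^ r * C(n, M) / C(n, k) ^ 2]. *)
pose M := (k + k - r)%N.
pose c : R := k`!%:R ^+ 2 / M`!%:R.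
have c_gt0 : 0 < c by rewrite divr_gt0 ?exprn_gt0 ?ltr0n ?fact_gt0.
exists (\sum_e \sum_e' phi e * phi e' * ((gram o k e e')%:R * c)); split.
  under eq_bigr do under eq_bigr do rewrite mulrA.
  under eq_bigr do rewrite -mulr_suml.
  by rewrite -mulr_suml mulr_gt0 // (gram_form_gt0 _ phi0).
have secondE n : n%:R ^+ r * expect p (fun w : n.-tuple Sigma => density f w ^+ 2)
    = \sum_e \sum_e' phi e * phi e' * (\sum_(m < M.+1)
        (overlaps o m e e')%:R * (n%:R ^+ r * 'C(n, m)%:R / 'C(n, k)%:R ^+ 2)).
  rewrite fE (expect_density_mul p_sum orth one) // mulr_sumr.
  apply: eq_bigr => e _; rewrite mulr_sumr; apply: eq_bigr => e' _.
  have [->|/phi_r re] := eqVneq (phi e) 0; first by rewrite !mul0r mulr0.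
  rewrite mulrCA; congr (_ * _).
  rewrite (big_ord_support (M := M) (F := fun m => 'C(n, m) * overlaps o m e e')%N).
  - rewrite natr_sum mulr_suml mulr_sumr; apply: eq_bigr => m _.
    by rewrite natrM; ring.
  - by move=> m ltm; rewrite bin_small // mul0n.
  - by rewrite /M => m ltm; rewrite overlaps_eq0 ?muln0 // re !size_tuple; lia.
under eq_fun do rewrite secondE.
apply: cvg_sumr => e; apply: cvg_sumr => e'.
have [phi0'|] := eqVneq (phi e * phi e') 0.
  by rewrite phi0' mul0r; under eq_fun do rewrite mul0r; apply: cvg_cst.
rewrite mulf_eq0 negb_or => /andP[/phi_r re /phi_r re'].
apply: cvgMl_tmp.
(* Only the top term [m = M] survives in the limit, and there [overlaps] equals [gram]. *)
have -> : (gram o k e e')%:R * c = \sum_(m < M.+1) (overlaps o m e e')%:R *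
    (if (m + r == k + k)%N then k`!%:R ^+ 2 / m`!%:R else 0).
  rewrite big_ord_recr /= big1 ?add0r => [|m _].
    rewrite /M subnK ?eqxx; last by lia.
    rewrite (overlaps_gram (K := k)) ?size_tuple ?re ?re' //; lia.
  by rewrite ifN ?mulr0 //; have := ltn_ord m; rewrite {2}/M; lia.
apply: cvg_sumr => m; apply: cvgMl_tmp; apply: cvg_bin_ratio.
by have := ltn_ord m; rewrite {2}/M; lia.
Qed.
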